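(* Let $G$ be a chordal graph on at least $3$ vertices and let $\mathcal A(G)$ be the family of overspan graphs for $G$ (with respect to a tree representation $(T_0,\mathcal F)$ of $G$ with $|V(T_0)|$ minimum and an independent set $I$, as described in the context). Assume that one edge (possibly a loop) can be chosen from each member of $\mathcal A(G)$ in such a way that the chosen edges form a matching in $G_{\mathcal A}$. Then $G$ is Hamiltonian.
   Context: A tree representation of a graph $G$ is a tree $T_0$ with a family $\mathcal F=\{F_v: v\in V(G)\}$ of subtrees of $T_0$ such that for distinct $u,v$, $uv\in E(G)$ iff $F_u$ and $F_v$ share a vertex. Fix one with $|V(T_0)|$ minimum. Choose an independent set $I$ of $G$ maximal with the property that for each $v\in I$, $F_v$ is a path all of whose vertices have degree at most $2$ in $T_0$; moreover $I$ is chosen so that for every $v\in I$, $F_v$ contains no member of $\mathcal F$ as a proper subgraph. For $v\in I$, $F_v$ is an $I$-path (trivial if it is a single vertex, which is then its endvertex). Colour each edge of $T_0$ red if it lies in some $I$-path and black otherwise. The base tree $T$ is obtained from $T_0$ by suppressing, one by one, every degree-$2$ vertex that is not an endvertex of any $I$-path; edges of $T$ inherit the colours (each edge of $T$ replaces a path of $T_0$ whose edges all have the same colour). Vertices of $T_0$ that remain in $T$ are substantial. Each red edge of $T$ corresponds to a unique non-trivial $I$-path. For an edge $e=rs$ of $T$, the overspan graph $A_e$ has vertex set $V(G)\setminus I$; it has a loop at $v$ if $F_v$ contains both $r$ and $s$, and an edge between distinct $u,v$ if $uv\in E(G)$ and ($r\in V(F_u)$, $s\in V(F_v)$ or vice versa).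 The family $\mathcal A(G)$ contains one graph $A_e$ for each red edge $e$ of $T$ and two copies of $A_e$ (considered as distinct members) for each black edge $e$ of $T$. For $\mathcal B\subseteq\mathcal A(G)$, $G_{\mathcal B}$ is the graph on $V(G)\setminus I$ whose edge set (including loops) is the union of the edge sets of the members of $\mathcal B$; $G_{\mathcal A}=G_{\mathcal A(G)}$. A matching may contain loops, provided all edges of the matching (loops included) are pairwise vertex-disjoint. *)

(* Defs.v *)
From mathcomp Require Import all_boot.

Set Implicit Arguments.
Unset Strict Implicit.
Unset Printing Implicit Defensive.

Record sgraph := SGraph {
  vertex :> finType;
  adj : rel vertex;
  adj_sym : symmetric adj;
  adj_irr : irreflexive adj }.

Section Graphs.
Variable G : sgraph.
Implicit Types (x y : G) (c : seq G) (A : {set G}).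

Definition degree x := #|[set y | adj x y]|.

Definition chordal :=
  forall c, ucycle (@adj G) c -> 3 < size c ->
    exists x y, [/\ x \in c, y \in c, adj x y, y != next c x & x != next c y].

Definition hamiltonian :=
  exists c, [/\ ucycle (@adj G) c, 2 < size c & forall x, x \in c].

Definition independent A := {in A &, forall x y, ~~ adj x y}.

Definition acyclic := forall c, ucycle (@adj G) c -> size c <= 2.

Definition induced A : rel G := [rel x y | [&& x \in A, y \in A & adj x y]].

Definition connected_in A := {in A &, forall x y, connect (induced A) x y}.

Definition is_tree := [/\ 0 < #|G|, connected_in [set: G] & acyclic].

(* A subtree of a tree is the subgraph induced by its vertex set, so subtrees
   are represented by vertex sets; the same applies to paths in a tree. *)
Definition is_subtree A := A != set0 /\ connected_in A.

Definition is_path A :=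
  exists x p, [/\ path (@adj G) x p, uniq (x :: p) & A =i x :: p].

(* The vertex of a one-vertex path is an endvertex. *)
Definition endvertex A x := (x \in A) && (#|[set y in A | adj x y]| <= 1).

End Graphs.

Section TreeRepresentations.
Variable G : sgraph.

Definition tree_rep (T0 : sgraph) (F : G -> {set T0}) :=
  [/\ is_tree T0, forall v, is_subtree (F v) &
      forall u v, u != v -> adj u v = ~~ [disjoint F u & F v]].

Definition min_tree_rep (T0 : sgraph) (F : G -> {set T0}) :=
  tree_rep F /\
  forall (T1 : sgraph) (F1 : G -> {set T1}), tree_rep F1 -> #|T0| <= #|T1|.

End TreeRepresentations.

(* Meant for a vertex x of degree 2 in a tree r. *)
Definition suppress (T : finType) (r : rel T) (x : T) : rel T :=
  [rel a b | [&& a != x, b != x & r a b || [&& a != b, r a x & r x b]]].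

Definition edge_set (T : finType) (r : rel T) : {set {set T}} :=
  [set e | [exists x, exists y, (e == [set x; y]) && r x y]].

(* Graphs with loops on a subset of the vertices of G are given by their edge
   sets: a singleton [set v] is a loop, [set u; v] with u != v is an edge. *)
Definition is_matching (T : finType) (H M : {set {set T}}) :=
  (M \subset H) && trivIset M.

Section Overspan.
Variables (G T0 : sgraph) (F : G -> {set T0}) (I : {set G}).

Definition I_admissible (J : {set G}) :=
  independent J /\
  forall v, v \in J -> is_path (F v) /\ forall t, t \in F v -> degree t <= 2.

Definition I_choice :=
  [/\ I_admissible I,
      forall J : {set G}, I_admissible J -> I \subset J -> J = I &
      forall v w, v \in I -> ~~ (F w \proper F v)].

Definition red0 : rel T0 :=
  [rel r s | adj r s && [exists v in I, (r \in F v) && (s \in F v)]].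

Definition insubstantial : {set T0} :=
  [set t | (degree t == 2) && ~~ [exists v in I, endvertex (F v) t]].

Definition base_adj : rel T0 := foldl (@suppress T0) (@adj T0) (enum insubstantial).

(* Suppression only merges edges of the same colour, so the red edges of the
   base tree are obtained by suppressing in the red subgraph. *)
Definition base_red : rel T0 := foldl (@suppress T0) red0 (enum insubstantial).

Definition base_edges : {set {set T0}} := edge_set base_adj.
Definition red_edges : {set {set T0}} := base_edges :&: edge_set base_red.
Definition black_edges : {set {set T0}} := base_edges :\: red_edges.

(* (r, s) ranges over both orderings of the ends of e. *)
Definition overspan (e : {set T0}) : {set {set G}} :=
  [set [set v] | v in ~: I & e \subset F v] :|:
  [set [set u; v] | u in ~: I, v in ~: I & adj u v &&
     [exists r, exists s, [&& e == [set r; s], r \in F u & s \in F v]]].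

(* The member (e, b) is a copy of overspan e: red edges have the single copy
   (e, false), black edges the two copies (e, false) and (e, true). *)
Definition overspan_family : {set {set T0} * bool} :=
  [set a | (a.1 \in red_edges) && ~~ a.2 || (a.1 \in black_edges)].

Definition union_graph (B : {set {set T0} * bool}) : {set {set G}} :=
  \bigcup_(a in B) overspan a.1.

(* Distinct members, including the two copies for a black edge, must be given
   distinct edges. *)
Definition matching_choice (f : {set T0} * bool -> {set G}) :=
  [/\ forall a, a \in overspan_family -> f a \in overspan a.1,
      {in overspan_family &, injective f} &
      is_matching (union_graph overspan_family) (f @: overspan_family)].

End Overspan.

(* Main.v *)
Require Import Defs.
From mathcomp Require Import all_boot.

Set Implicit Arguments.
Unset Strict Implicit.
Unset Printing Implicit Defensive.

(* Every [F w] meets the base tree [T]: otherwise [F w] is a path of vertices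
   of degree 2 avoiding the ends of the [I]-paths, so by maximality of [I] it
   lies properly inside an [I]-path.  Each edge [rs] of [T] carries two
   disjoint connections from [r] to [s]: the two chosen edges if [rs] is black,
   the chosen edge and the vertex of the corresponding [I]-path if [rs] is red.
   Hence a closed walk through [r] can be extended by an excursion to [s], and
   as [T] is connected, such excursions lead to a closed walk visiting all of
   [T].  Any vertex [w] of [G] that is still missing is inserted at a visit to
   a vertex of [F w]. *)

(** * Closed walks that record visits to tree vertices *)

Section ClosedWalks.
Variables (G : sgraph) (T : finType) (F : G -> {set T}).
Hypothesis adjI : forall u v t, u != v -> t \in F u -> t \in F v -> adj u v.

(* A closed walk is a cyclic word in which a letter [inr t] records a visit to
   the tree vertex [t]; all vertices of [G] next to it contain [t]. *)
Definition step : rel (G + T) := fun x y =>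
  match x, y with
  | inl u, inl v => (u == v) || adj u v
  | inl u, inr t | inr t, inl u => t \in F u
  | inr s, inr t => s == t
  end.

Definition letters : seq (G + T) -> seq G :=
  pmap (fun x => if x is inl w then Some w else None).

Lemma mem_letters c w : (w \in letters c) = (inl w \in c).
Proof. by elim: c => [|[v|t] c IHc] //=; rewrite !inE IHc. Qed.

Lemma letters_map l : letters (map inl l) = l.
Proof. by elim: l => [|x l IHl] //=; rewrite IHl. Qed.

Lemma letters_rcons c u : letters (rcons c (inl u)) = rcons (letters c) u.
Proof. by rewrite /letters -!cats1 pmap_cat. Qed.

(** Consecutive visits repeat one tree vertex, so letters separated only by visits share it and are
    equal or adjacent. The condition on [x] says that [u] can be the last letter read so far. *)
Lemma path_letters x u p :
    (if x is inr t then t \in F u else x = inl u) -> path step x p ->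
  path [rel a b | (a == b) || adj a b] u (letters p).
Proof.
elim: p x u => [|[v|t] p IHp] [w|s] u //=.
- case=> -> /andP[-> /= /IHp]; exact.
- move=> sFu /andP[sFv /IHp-> //]; rewrite andbT.
  by case: (altP (u =P v)) => //= neq_uv; exact: adjI sFu sFv.
- case=> -> /andP[tFu /IHp]; exact.
- move=> sFu /andP[/eqP <- /IHp]; exact.
Qed.

Lemma path_irrefl u (p : seq G) :
  path [rel a b | (a == b) || adj a b] u p -> uniq (u :: p) -> path (@adj G) u p.
Proof.
elim: p u => //= v p IHp u /andP[/orP[/eqP->|->] Pp]; first by rewrite mem_head.
by case/andP=> _ Up; apply: IHp.
Qed.

Lemma cycle_letters c :
  cycle step c -> uniq (letters c) -> 1 < size (letters c) ->
  exists d : seq G, ucycle (@adj G) d /\ perm_eq d (letters c).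
Proof.
move=> Cc Uc Sc.
have [u uc]: exists u, inl u \in c.
  case Dl: (letters c) Sc => [|u l] // _.
  by exists u; rewrite -mem_letters Dl mem_head.
have [i c' Dc] := rot_to uc.
have Pc: perm_eq (u :: letters c') (letters c).
  by rewrite -[u :: _]/(letters (inl u :: c')) -Dc perm_pmap // perm_rot.
exists (u :: letters c'); split=> //.
move: Cc Uc Sc; rewrite -(rot_cycle i) Dc -(perm_uniq Pc) -(perm_size Pc) /=.
move=> /(@path_letters _ u) => /(_ erefl); rewrite letters_rcons rcons_path.
move: (letters c') => l /andP[Pl adj_l] Ul lt0l.
rewrite /ucycle /= Ul andbT rcons_path path_irrefl //=.
(* As [l] is nonempty and avoids [u], its last letter differs from [u]. *)
case/orP: adj_l => // /eqP eq_lu.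
case: l Ul lt0l eq_lu {Pl Pc} => //= v l /andP[u'l _] _ Du.
by rewrite -Du mem_last in u'l.
Qed.

(** A closed excursion from [t] fits in right after a visit to [t], because its final [inr t] can
    precede the old successor. *)
Lemma splice c t d :
  cycle step c -> inr t \in c -> path step (inr t) (rcons d (inr t)) ->
  exists2 c', cycle step c' & perm_eq c' (c ++ rcons d (inr t)).
Proof.
move=> Cc tc Pd; have [i c' Dc] := rot_to tc.
exists (inr t :: rcons d (inr t) ++ c').
  move: Cc; rewrite -(rot_cycle i) Dc /= rcons_cat cat_path Pd.
  by rewrite last_rcons.
rewrite perm_sym (@perm_trans _ ((inr t :: c') ++ rcons d (inr t))) //.
  by rewrite -Dc perm_cat2r perm_sym perm_rot.
by rewrite /= perm_cons perm_catC.
Qed.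

(** * Excursions along the edges of the base tree *)

Variables (E : rel T) (tok : {set T} * bool -> {set G}).
Hypothesis E_sym : symmetric E.
(** [tok (e, b)] is the vertex set of the connection [b] across the edge [e]; the list [l] orders it
    in the direction of travel. *)
Hypothesis tok_link : forall r s b, E r s ->
  exists l, [/\ uniq l, l =i tok ([set r; s], b)
              & path step (inr r) (rcons (map inl l) (inr s))].
Hypothesis tok_disj : forall r s r' s' b b', E r s -> E r' s' ->
  ([set r; s], b) <> ([set r'; s'], b') ->
  [disjoint tok ([set r; s], b) & tok ([set r'; s'], b')].

(** The last condition keeps every connection at an unvisited vertex free: a letter in use belongs
    to an edge with both ends visited. *)
Definition excursion_walk (c : seq (G + T)) :=
  [/\ cycle step c, uniq (letters c) &
      forall w, w \in letters c -> exists r s b,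
        [/\ E r s, inr r \in c, inr s \in c & w \in tok ([set r; s], b)]].

Lemma excursion c r s :
  excursion_walk c -> E r s -> inr r \in c ->
  exists c', [/\ excursion_walk c', {subset c <= c'} & inr s \in c'].
Proof.
move=> Wc Ers rc; have [sc|s'c] := boolP (inr s \in c); first by exists c; split.
have Esr: E s r by rewrite E_sym.
have [Cc Uc Tc] := Wc.
have [l1 [U1 D1 P1]] := tok_link false Ers.
(* The return from [s] to [r] uses the other connection of the same edge. *)
have [l2 [U2 D2 P2]] := tok_link true Esr.
pose d := rcons (map inl l1) (inr s) ++ map inl l2.
have Pd: path step (inr r) (rcons d (inr r)).
  by rewrite /d rcons_cat cat_path P1 last_rcons.
have [c' Cc' Dc'] := splice Cc rc Pd.
have mem_c' x : x \in c' = (x \in c) || (x \in rcons d (inr r)).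
  by rewrite (perm_mem Dc') mem_cat.
have cc': {subset c <= c'} by move=> x xc; rewrite mem_c' xc.
have sc': inr s \in c' by rewrite mem_c' mem_rcons inE mem_cat mem_rcons mem_head !orbT.
exists c'; split=> //.
have Dl: perm_eq (letters c') (letters c ++ l1 ++ l2).
  rewrite (perm_trans (perm_pmap _ Dc')) // pmap_cat /d -!cats1 !pmap_cat /= cats0.
  by rewrite cats0 -!/(letters _) !letters_map.
(* The edge that an old letter comes from has both ends visited, so it is not [rs], as [s] is
   unvisited. *)
have new w b : w \in letters c -> w \notin tok ([set r; s], b).
  move=> /Tc[r1 [s1 [b1 [E1 r1c s1c]]]] w1.
  rewrite (disjointFr (tok_disj E1 Ers _) w1) // => -[Drs _].
  have: s \in [set r1; s1] by rewrite Drs !inE eqxx orbT.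
  by rewrite !inE => /orP[]/eqP Ds; rewrite Ds ?r1c ?s1c in s'c.
have D2' : l2 =i tok ([set r; s], true) by move=> w; rewrite D2 setUC.
split=> //.
  rewrite (perm_uniq Dl) !cat_uniq Uc U1 U2 andbT /=; apply/andP; split.
    apply/hasPn=> w; rewrite mem_cat D1 D2' => w12; apply/negP=> wc.
    by case/orP: w12; apply/negP; apply: new.
  apply/hasPn=> w; rewrite D2' /= D1 => w2.
  by rewrite (disjointFl (tok_disj Ers Ers _) w2).
move=> w; rewrite (perm_mem Dl) !mem_cat => /or3P[/Tc|w1|w2].
- move=> [r1 [s1 [b1 [E1 r1c s1c w1]]]].
  by exists r1, s1, b1; split; rewrite // cc'.
- by exists r, s, false; split; rewrite -?D1 // cc'.
- by exists r, s, true; split; rewrite -?D2' // cc'.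
Qed.

Lemma excursion_path p c r :
  excursion_walk c -> path E r p -> inr r \in c ->
  exists c', [/\ excursion_walk c', {subset c <= c'} & inr (last r p) \in c'].
Proof.
elim: p c r => [|s p IHp] c r Wc /=; first by exists c; split.
case/andP=> Ers Pp rc; have [c1 [W1 cc1 s1]] := excursion Wc Ers rc.
have [c2 [W2 c12 last2]] := IHp _ _ W1 Pp s1.
by exists c2; split=> // x /cc1/c12.
Qed.

Lemma excursion_walk_all t0 (ts : seq T) :
  {in ts, forall t, connect E t0 t} ->
  exists c, [/\ excursion_walk c, inr t0 \in c & {in ts, forall t, inr t \in c}].
Proof.
elim: ts => [|t ts IHts] conn.
  by exists [:: inr t0]; split; rewrite ?mem_head //; split; rewrite //= eqxx.
have [|c [Wc t0c tsc]] := IHts; first by move=> s sts; rewrite conn ?inE ?sts ?orbT.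
have /connectP[p Pp Dt] := conn t (mem_head _ _).
have [c' [Wc' cc' tc']] := excursion_path Wc Pp t0c.
exists c'; split; rewrite ?cc' // => s; rewrite inE => /predU1P[->|/tsc/cc' //].
by rewrite Dt.
Qed.

(** A missing [w] becomes a detour [t], [w], [t] at a visited [t] in [F w]. Old visits survive, so
    this can be repeated for all of [ws]. *)
Lemma insert_letters c (ws : seq G) :
    cycle step c -> uniq (letters c) ->
    (forall w, exists2 t, t \in F w & inr t \in c) ->
  exists c', [/\ cycle step c', uniq (letters c'), {subset c <= c'} &
                 {in ws, forall w, w \in letters c'}].
Proof.
move=> Cc Uc visit; elim: ws => [|w ws [c1 [C1 U1 cc1 ws1]]]; first by exists c; split.
have [wc1|w'c1] := boolP (w \in letters c1).
  by exists c1; split=> // v; rewrite inE => /predU1P[->|/ws1].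
have [t tFw /cc1 tc] := visit w.
have [|c2 C2 D2] := @splice c1 t [:: inl w] C1 tc; first by rewrite /= tFw.
have Dl: perm_eq (letters c2) (rcons (letters c1) w).
  by rewrite (perm_trans (perm_pmap _ D2)) // pmap_cat cats1.
exists c2; split=> //.
- by rewrite (perm_uniq Dl) rcons_uniq w'c1.
- by move=> x /cc1 xc1; rewrite (perm_mem D2) mem_cat xc1.
- move=> v; rewrite (perm_mem Dl) mem_rcons !inE => /orP[->//|/ws1->].
  by rewrite orbT.
Qed.

(** In the application, suppressed vertices stay in [T] without edges; hence the tour covers only
    the component of [t0]. *)
Lemma hamiltonian_of_links t0 :
  2 < #|G| -> (forall w, exists2 t, t \in F w & connect E t0 t) -> hamiltonian G.
Proof.
move=> G_ge3 meetE.
have [|c [[Cc Uc _] _ tc]] := @excursion_walk_all t0 [seq t <- enum T | connect E t0 t].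
  by move=> t; rewrite mem_filter => /andP[].
have [|c' [Cc' Uc' _ all_c']] := insert_letters (enum G) Cc Uc.
  move=> w; have [t tFw ct] := meetE w; exists t => //.
  by apply: tc; rewrite mem_filter ct mem_enum.
have {}all_c' w : w \in letters c' by apply: all_c'; rewrite mem_enum.
have size_c' : size (letters c') = #|G|.
  by rewrite -(card_uniqP Uc'); apply: eq_card => w; rewrite all_c'.
have [|d [Ud Dd]] := cycle_letters Cc' Uc'; first by rewrite size_c' ltnW.
by exists d; split; rewrite ?(perm_size Dd) ?size_c' // => w; rewrite (perm_mem Dd).
Qed.

End ClosedWalks.

(** * Suppression of vertices and connectivity *)

Section Suppression.
Variable T : finType.
Implicit Types (r : rel T) (x a b : T) (s : seq T).

Lemma suppress_sym r x : symmetric r -> symmetric (suppress r x).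
Proof.
move=> r_sym; suff sub a b: suppress r x a b -> suppress r x b a.
  by move=> a b; apply/idP/idP; apply: sub.
rewrite /suppress /= => /and3P[-> -> /=]; rewrite (r_sym b a) (r_sym b x) (r_sym x a).
by rewrite (eq_sym b a) (andbC (r x b)).
Qed.

(** A passage [a], [x], [z] of the walk is replaced by the new edge [az], or dropped if [a = z]. *)
Lemma suppress_connect r x a b :
  symmetric r -> a != x -> b != x -> connect r a b -> connect (suppress r x) a b.
Proof.
move=> r_sym ax bx /connectP[p Pp Db]; rewrite Db in bx *.
(* Induction on a bound for the length, as bypassing [x] consumes two edges at once. *)
elim: {p}(size p) {-2}p (leqnn (size p)) a ax bx Pp {Db b}
  => [|n IHn] [|y p] //= le_pn a ax bx.
case/andP=> ray Pp; have [Dy|yx] := eqVneq y x; last first.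
  by apply: connect_trans (IHn _ _ _ yx bx Pp); rewrite ?connect1 // /suppress /= ax yx ray.
subst y; case: p Pp bx le_pn => [|z p] /=; first by rewrite eqxx.
case/andP=> rxz Pp bx le_pn.
have [Dz|zx] := eqVneq z x.
  by subst z; apply: (IHn (x :: p)); rewrite //= ?ray.
have [Dz|neq_az] := eqVneq a z.
  by subst z; apply: IHn => //; apply: ltnW.
apply: connect_trans (IHn _ _ _ zx bx Pp); last exact: ltnW.
by rewrite connect1 // /suppress /= ax zx neq_az ray rxz orbT.
Qed.

Lemma foldl_suppress_sym s r : symmetric r -> symmetric (foldl (@suppress T) r s).
Proof. by elim: s r => //= x s IHs r r_sym; apply/IHs/suppress_sym. Qed.

Lemma foldl_suppress_irr s r : irreflexive r -> irreflexive (foldl (@suppress T) r s).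
Proof. by elim: s r => //= x s IHs r r_irr; apply: IHs => a; rewrite /suppress /= r_irr eqxx !andbF. Qed.

Lemma foldl_suppress_connect s r a b :
  symmetric r -> a \notin s -> b \notin s -> connect r a b ->
  connect (foldl (@suppress T) r s) a b.
Proof.
elim: s r => //= x s IHs r r_sym; rewrite !inE !negb_or.
move=> /andP[ax a's] /andP[bx b's] rab.
by apply: IHs => //; [apply: suppress_sym | apply: suppress_connect].
Qed.

Lemma foldl_suppress_isolated s r a b :
  (forall b, r a b = false) -> foldl (@suppress T) r s a b = false.
Proof.
elim: s r => //= x s IHs r ra; apply: IHs => {}b.
by rewrite /suppress /= !ra !andbF.
Qed.

(** Suppressing [a] removes all its edges, and later suppressions create none at an isolated
    vertex. *)
Lemma foldl_suppress_notin s r a b : foldl (@suppress T) r s a b -> a \notin s.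
Proof.
elim: s r => //= x s IHs r rab; rewrite inE negb_or (IHs _ rab) andbT.
by apply: contraL rab => /eqP->; rewrite foldl_suppress_isolated // => c; rewrite /suppress /= eqxx.
Qed.

End Suppression.

(** * Paths and their endvertices *)

Section Paths.
Variable T : sgraph.
Implicit Types (A : {set T}) (x y z : T).

Definition nbrs A x := [set y in A | adj x y].

Lemma degree_gt A x y :
  y \notin A -> adj x y -> 1 < #|nbrs A x| -> 2 < degree x.
Proof.
move=> y'A xy gt1.
have: y |: nbrs A x \subset [set z | adj x z].
  by apply/subsetP=> z; rewrite !inE => /predU1P[->|/andP[]].
by move/subset_leq_card; apply: leq_trans; rewrite cardsU1 inE (negbTE y'A) ltnS.
Qed.

Lemma nbrs_interior A x p z :
    path (@adj T) x p -> uniq (x :: p) -> {subset x :: p <= A} ->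
    z \in x :: p -> z != x -> z != last x p ->
  1 < #|nbrs A z|.
Proof.
move=> Pp Up pA; rewrite inE => /predU1P[->|zp]; first by rewrite eqxx.
move=> _ zl; case/splitPr: zp Pp Up pA zl => p1 [|y p2].
  by rewrite last_cat /= eqxx.
rewrite -cat_cons cat_path cat_uniq => /andP[_ /and3P[adj1 adj2 _]] /and3P[_ /hasPn Hn _] pA _.
have l1: last x p1 \in x :: p1 by apply: mem_last.
have neq_ly: last x p1 != y.
  by apply: contraTneq l1 => ->; apply: Hn; rewrite !inE eqxx orbT.
apply: (@leq_trans #|[set last x p1; y]|); first by rewrite cards2 neq_ly.
apply/subset_leq_card/subsetP=> t; rewrite !inE => /orP[]/eqP->.
  by rewrite adj_sym adj1 pA // mem_cat l1.
by rewrite adj2 pA // mem_cat !inE eqxx !orbT.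
Qed.

Lemma endvertices_le2 A : is_path A -> #|[set x | endvertex A x]| <= 2.
Proof.
move=> [x [p [Pp Up DA]]].
apply: (@leq_trans #|[set x; last x p]|); last by rewrite cards2; case: (_ != _).
apply/subset_leq_card/subsetP=> z; rewrite !inE => /andP[zA le1].
apply: contraLR le1; rewrite negb_or -ltnNge => /andP[zx zl].
by apply: nbrs_interior Pp Up _ _ zx zl => [y|]; rewrite -DA.
Qed.

(** The first vertex of the path will do: a neighbour beyond the second vertex would close a cycle
    of length at least 3. *)
Lemma path_has_endvertex A : acyclic T -> is_path A -> exists x, endvertex A x.
Proof.
move=> acT [x [p [Pp Up DA]]]; exists x; rewrite /endvertex DA mem_head /=.
case: p Pp Up DA => [|y p] Pp Up DA.
  apply/card_le1_eqP=> u v; rewrite !inE !DA !inE.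
  by move=> /andP[/eqP->]; rewrite adj_irr.
apply/card_le1_eqP; suff Dy u: u \in [set z in A | adj x z] -> u = y.
  by move=> u v /Dy-> /Dy->.
rewrite !inE DA !inE => /andP[/or3P[/eqP->|/eqP//|up] xu].
  by rewrite adj_irr in xu.
case/splitPr: up Pp Up {DA} => p1 p2.
rewrite -cat_rcons -cat_cons cat_path => /andP[Pp _].
rewrite -[uniq _]/(uniq ((x :: y :: rcons p1 u) ++ p2)) cat_uniq => /andP[Up _].
have /acT : ucycle (@adj T) (x :: y :: rcons p1 u).
  rewrite /ucycle Up andbT.
  suff: path (@adj T) x (rcons (y :: rcons p1 u) x) by [].
  by rewrite rcons_path Pp /= last_rcons adj_sym.
by rewrite /= size_rcons.
Qed.

Lemma connected_boundary A (B : pred T) a b :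
    connected_in A -> a \in A -> B a -> b \in A -> ~~ B b ->
  exists x y, [/\ x \in A, B x, y \in A, ~~ B y & adj x y].
Proof.
move=> cA aA Ba bA; have /connectP[p Pp ->] := cA a b aA bA.
elim: p a aA Ba Pp => [|y p IHp] a aA Ba /=; first by rewrite Ba.
case/andP=> /and3P[_ yA ay] Pp; have [By|By] := boolP (B y); first exact: IHp Pp.
by exists a, y.
Qed.

(** A path inside [A] is grown. Connectivity supplies an edge of [A] leaving it; this edge starts at
    an end of the path, since an interior vertex would get degree at least 3. *)
Lemma is_path_degree2 A :
  is_subtree A -> {in A, forall t, degree t <= 2} -> is_path A.
Proof.
move=> [/set0Pn[x0 x0A] cA] deg2.
(* [n] is fuel: each extension lengthens [p] by one, and at [n = 0] the path would have more
   vertices than [A]. *)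
suff main n x p: path (@adj T) x p -> uniq (x :: p) -> {subset x :: p <= A} ->
    #|A| < size p + n -> is_path A.
  apply: (main #|A|.+1 x0 [::]) => //= y.
  by rewrite inE => /eqP->.
elim: n x p => [|n IHn] x p Pp Up pA lt_An.
  have: size (x :: p) <= #|A| by rewrite cardE uniq_leq_size // => y /pA; rewrite mem_enum.
  by rewrite leqNgt /= ltnS ltnW //; rewrite addn0 in lt_An.
have [/subsetP Ap|] := boolP (A \subset x :: p).
  by exists x, p; split=> // y; apply/idP/idP => [/Ap|/pA].
case/subsetPn=> b bA b'p.
have xA: x \in A by rewrite pA ?mem_head.
have [z [y [zA zp yA y'p zy]]] :=
  @connected_boundary A (mem (x :: p)) x b cA xA (mem_head _ _) bA b'p.
rewrite /= in zp y'p.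
have [Dz|zx] := eqVneq z x.
  apply: (IHn y (x :: p)); rewrite /= ?y'p ?Pp -?Dz 1?adj_sym ?zy //.
  - by rewrite Dz.
  - by move=> t; rewrite inE => /predU1P[->|]; rewrite ?Dz => // /pA.
  - by rewrite addSnnS.
have [Dz|zl] := eqVneq z (last x p).
  apply: (IHn x (rcons p y)); rewrite ?rcons_path -?Dz ?Pp -?rcons_cons ?rcons_uniq ?y'p //.
    by move=> t; rewrite mem_rcons inE => /predU1P[->|/pA].
  by rewrite size_rcons addSnnS.
have := deg2 z zA; rewrite leqNgt => /negP[].
apply: (@degree_gt [set u in x :: p] z y) => //; first by rewrite in_set.
by apply: nbrs_interior Pp Up _ zp zx zl => u up; rewrite in_set.
Qed.

End Paths.

(** * The base tree and the [I]-paths *)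

Section BaseTree.
Variables (G T0 : sgraph) (F : G -> {set T0}) (I : {set G}).
Hypotheses (F_rep : tree_rep F) (I_ok : I_choice F I).

Lemma rep_adj u v t : u != v -> t \in F u -> t \in F v -> adj u v.
Proof.
case: F_rep => _ _ adjF uv tu tv; rewrite adjF //.
by apply/pred0Pn; exists t; rewrite /= tu tv.
Qed.

Lemma I_path_inj u v t : u \in I -> v \in I -> t \in F u -> t \in F v -> u = v.
Proof.
case: I_ok => -[indI _] _ _ uI vI tu tv; apply/eqP.
by apply: contraTT isT => uv; have /negP[] := indI u v uI vI; apply: rep_adj tv.
Qed.

(** Either [t] has degree at most 1, or it ends some [I]-path, which must be [F v] because distinct
    [I]-paths are disjoint. *)
Lemma substantial_endvertex v t :
  v \in I -> t \in F v -> t \notin insubstantial F I -> endvertex (F v) t.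
Proof.
move=> vI tv; case: I_ok => -[_ /(_ v vI)[_ /(_ t tv) deg2]] _ _.
rewrite inE negb_and negbK => /orP[deg|/existsP[w /andP[wI end_w]]]; last first.
  by rewrite (I_path_inj vI wI tv (proj1 (andP end_w))).
rewrite /endvertex tv /= -ltnS; apply: (@leq_trans (degree t).+1).
  by apply/subset_leq_card/subsetP=> y; rewrite !inE => /andP[].
by rewrite ltn_neqAle deg.
Qed.

Lemma endvertex_substantial v t :
  v \in I -> endvertex (F v) t -> t \notin insubstantial F I.
Proof.
move=> vI end_t; rewrite inE negb_and negbK; apply/orP; right.
by apply/existsP; exists v; rewrite vI.
Qed.

Lemma meets_substantial w : exists2 t, t \in F w & t \notin insubstantial F I.
Proof.
have [[_ _ acT] subF adjF] := F_rep.
have [[indI pathI] maxI minI] := I_ok.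
have I_end v : v \in I -> exists x, endvertex (F v) x.
  by move=> /pathI[Pv _]; apply: path_has_endvertex.
have [wI|w'I] := boolP (w \in I).
  have [x end_x] := I_end w wI; exists x; last exact: endvertex_substantial end_x.
  by case/andP: end_x.
apply/exists_inP; apply: contraR w'I => /exists_inPn all_w.
have {}all_w t : t \in F w -> t \in insubstantial F I by move/all_w; rewrite negbK.
have deg_w t : t \in F w -> degree t = 2 by move/all_w; rewrite inE => /andP[/eqP].
have cw := proj2 (subF w).
have [/exists_inP[v vI wv]|/exists_inPn nadj] := boolP [exists v in I, adj w v].
  have wNv : w != v by apply: contraTneq wv => ->; rewrite adj_irr.
  move: (wv); rewrite adjF // => /pred0Pn[a /andP[/= aw av]].
  have not_end t : t \in F w -> ~~ endvertex (F v) t.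
    by move/all_w; apply: contraL; apply: endvertex_substantial.
  (* If [F w] left [F v] at [x], then [x], not being an endvertex of [F v], would have degree at
     least 3. The inclusion is proper since [F w] misses the endvertices of [F v]. *)
  case/negP: (minI v w vI); rewrite properE; apply/andP; split.
    apply/negPn/negP=> /subsetPn[b bw b'v].
    have [x [y [xw xv yw y'v xy]]] :=
      @connected_boundary _ (F w) (mem (F v)) a b cw aw av bw b'v.
    have := not_end x xw; rewrite /endvertex [x \in F v]xv /= -ltnNge => gt1.
    by have := degree_gt y'v xy gt1; rewrite deg_w.
  have [x end_x] := I_end v vI; apply/subsetPn; exists x; first by case/andP: end_x.
  by apply: contraL end_x; apply: not_end.
(* With no neighbour in [I], the vertex [w] can be added to [I], against maximality. *)
suff <-: w |: I = I by rewrite setU11.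
apply: maxI; rewrite ?subsetU1 //; split.
  move=> x y; rewrite !inE => /predU1P[->|xI] /predU1P[->|yI]; rewrite ?adj_irr //.
  - exact: nadj.
  - by rewrite adj_sym nadj.
  - exact: indI.
move=> v; rewrite !inE => /predU1P[->|/pathI//].
by split; [apply: is_path_degree2 => // t /deg_w-> | move=> t /deg_w->].
Qed.

Local Notation E := (base_adj F I).

Lemma base_adj_sym : symmetric E.
Proof. exact/foldl_suppress_sym/adj_sym. Qed.

Lemma base_adj_neq r s : E r s -> r != s.
Proof.
by apply: contraTneq => ->; rewrite /base_adj foldl_suppress_irr //; apply: adj_irr.
Qed.

Lemma base_adj_substantial r s : E r s -> r \notin insubstantial F I.
Proof. by move/foldl_suppress_notin; rewrite mem_enum. Qed.

Lemma base_connect r s :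
  r \notin insubstantial F I -> s \notin insubstantial F I -> connect E r s.
Proof.
move=> r_sub s_sub; apply: foldl_suppress_connect; rewrite ?mem_enum //.
  exact: adj_sym.
have [[_ cT _] _ _] := F_rep.
by apply: connect_sub (cT r s (in_setT _) (in_setT _)) => x y /and3P[_ _ /connect1].
Qed.

(** Lying in a common [I]-path is preserved by suppression: two merged edges share [x], so their
    [I]-paths coincide. *)
Lemma base_red_I_path r s :
  base_red F I r s -> exists2 v, v \in I & (r \in F v) && (s \in F v).
Proof.
rewrite /base_red.
have: forall a b, red0 F I a b -> exists2 v, v \in I & (a \in F v) && (b \in F v).
  by move=> a b /andP[_ /exists_inP].
elim: (enum _) (red0 F I) => [|x l IHl] q Hq /=; first exact: Hq.
apply: IHl => a b /and3P[_ _ /orP[/Hq//|/and3P[_ /Hq[u uI /andP[au xu]]]]].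
case/Hq=> v vI /andP[xv bv].
by exists u => //; rewrite au (I_path_inj uI vI xu xv).
Qed.

(** The ends of a base edge are substantial, hence endvertices of [F v], of which there are at most
    two. *)
Lemma base_edge_in_I_path v r s r' s' : v \in I -> E r s -> E r' s' ->
    [set r; s] \subset F v -> [set r'; s'] \subset F v ->
  [set r; s] = [set r'; s'].
Proof.
move=> vI; suff eq_ends a b : E a b -> [set a; b] \subset F v ->
    [set a; b] = [set x | endvertex (F v) x].
  by move=> Ers Ers' /(eq_ends _ _ Ers)-> /(eq_ends _ _ Ers')->.
move=> Eab ab_v; apply/eqP; rewrite eqEcard cards2 base_adj_neq //.
have Eba: E b a by rewrite base_adj_sym.
have [[_ /(_ v vI)[path_v _]] _ _] := I_ok.
rewrite endvertices_le2 // andbT; move: ab_v; rewrite !subUset !sub1set !inE.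
case/andP=> av bv; rewrite !substantial_endvertex //.
  exact: base_adj_substantial Eba.
exact: base_adj_substantial Eab.
Qed.

Lemma red_edge_subset r s : [set r; s] \in red_edges F I ->
  exists2 v, v \in I & [set r; s] \subset F v.
Proof.
case/setIP=> _; rewrite inE => /existsP[x /existsP[y /andP[/eqP-> /base_red_I_path]]].
by case=> v vI xyv; exists v; rewrite // subUset !sub1set.
Qed.

(** * Connections from overspan edges and from [I]-paths *)

Lemma overspan_link r s e : r != s -> e \in overspan F I [set r; s] ->
  exists l, [/\ uniq l, l =i e & path (step F) (inr r) (rcons (map inl l) (inr s))].
Proof.
move=> rs /setUP[/imsetP[v]|].
  rewrite !inE => /andP[_]; rewrite subUset !sub1set => /andP[rv sv] ->.
  by exists [:: v]; split=> [//|w|]; rewrite ?inE //= rv sv.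
case/imset2P=> u v _; rewrite !inE.
case/and3P=> _ uv /existsP[r' /existsP[s' /and3P[/eqP Drs r'u s'v]]] ->.
have neq_uv: u != v by apply: contraTneq uv => ->; rewrite adj_irr.
(* The set of ends determines [r'] and [s'] only up to exchange, which decides the order of [u] and
   [v] in the list. *)
have: (r == r') && (s == s') || (r == s') && (s == r').
  have: r \in [set r'; s'] by rewrite -Drs set21.
  have: s \in [set r'; s'] by rewrite -Drs set22.
  rewrite !inE => /orP[]/eqP Ds /orP[]/eqP Dr; move: rs; rewrite Ds Dr ?eqxx ?orbT //.
case/orP=> /andP[/eqP-> /eqP->].
  exists [:: u; v]; split=> [|w|]; first by rewrite /= inE neq_uv.
    by rewrite !inE.
  by rewrite /= r'u uv s'v !orbT.
exists [:: v; u]; split=> [|w|]; first by rewrite /= inE eq_sym neq_uv.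
  by rewrite !inE orbC.
by rewrite /= s'v r'u adj_sym uv !orbT.
Qed.

Lemma overspan_notin e m v : v \in I -> m \in overspan F I e -> v \notin m.
Proof.
move=> vI /setUP[/imsetP[w]|/imset2P[u w]]; rewrite !inE.
  by case/andP=> w'I _ ->; rewrite inE; apply: contraNneq w'I => <-.
move=> u'I /andP[w'I _] ->; rewrite !inE negb_or.
by apply/andP; split; [apply: contraNneq u'I | apply: contraNneq w'I] => <-.
Qed.

Lemma hamiltonian_of_choice f : 2 < #|G| -> matching_choice F I f -> hamiltonian G.
Proof.
move=> G_ge3 [f_over f_inj /andP[_ /trivIsetP f_triv]].
(* For a red edge the absent second copy is replaced by the vertex of [I] whose path contains the
   edge. *)
pose tok (a : {set T0} * bool) :=
  if (a.1 \in red_edges F I) && a.2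
  then [set v in I | a.1 \subset F v] else f a.
have base_e r s : E r s -> [set r; s] \in base_edges F I.
  by move=> Ers; rewrite inE; apply/existsP; exists r; apply/existsP; exists s; rewrite eqxx.
have fam r s b : E r s ->
    ([set r; s], b) \in overspan_family F I = ~~ (([set r; s] \in red_edges F I) && b).
  move=> Ers; rewrite [LHS]inE /= [_ \in black_edges _ _]inE base_e // andbT.
  by case: (_ \in _); rewrite ?orbF.
have tokE r s b : E r s -> let a := ([set r; s], b) in
    (a \in overspan_family F I) /\ tok a = f a \/
    exists2 v, v \in I & [/\ b, [set r; s] \subset F v & tok a = [set v]].
  move=> Ers a; rewrite /a /tok fam //=; case: ifP => [/andP[red_e b1]|_]; last by left.
  have [v vI ev] := red_edge_subset red_e.
  right; exists v => //; split=> //; apply/setP=> w; rewrite !inE.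
  apply/andP/eqP=> [[wI ew]|->//]; have rrs: r \in [set r; s] by rewrite set21.
  exact: I_path_inj wI vI (subsetP ew r rrs) (subsetP ev r rrs).
have [w0 _]: exists w : G, w \in G by apply/card_gt0P; apply: leq_trans G_ge3.
have [t0 _ t0_sub] := meets_substantial w0.
apply: (@hamiltonian_of_links G T0 F rep_adj E tok base_adj_sym _ _ t0 G_ge3).
- move=> r s b Ers; have rs := base_adj_neq Ers.
  case: (tokE r s b Ers) => [[a_fam ->]|[v vI [_ ev ->]]].
    exact: overspan_link (f_over _ a_fam).
  move: ev; rewrite subUset !sub1set => /andP[rv sv].
  by exists [:: v]; split=> [//|w|]; rewrite ?inE //= rv sv.
- move=> r s r' s' b b' E1 E2 neq12.
  have [[a1 ->]|[v vI [b1 ev ->]]] := tokE r s b E1;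
    have [[a2 ->]|[v' v'I [b2 ev' ->]]] := tokE r' s' b' E2.
  (* Distinct members have distinct chosen edges, which the matching makes disjoint. *)
  + apply: f_triv; rewrite ?imset_f //.
    by apply: contra_not_neq neq12 => /f_inj; apply.
  + by rewrite disjoint_sym disjoints1; apply: overspan_notin (f_over _ a1).
  + by rewrite disjoints1; apply: overspan_notin (f_over _ a2).
  (* Two edges inside the same [I]-path coincide, and both flags are true here. *)
  + rewrite disjoints1 inE; apply: contra_not_neq neq12 => Dv; subst v'.
    by rewrite (base_edge_in_I_path vI E1 E2) // b1 b2.
- by move=> w; have [t tw t_sub] := meets_substantial w; exists t => //; apply: base_connect.
Qed.

End BaseTree.

Theorem lemma2p2 (G T0 : sgraph) (F : G -> {set T0}) (I : {set G})
  (G_chordal : chordal G) (G_ge3 : 3 <= #|G|)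
  (F_min : min_tree_rep F) (I_ok : I_choice F I)
  (G_choice : exists f : {set T0} * bool -> {set G}, matching_choice F I f) :
  hamiltonian G.
Proof.
case: F_min G_choice => F_rep _ [f f_choice].
exact: hamiltonian_of_choice F_rep I_ok f G_ge3 f_choice.
Qed.
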